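(* Let $F(\mathbf{x})=\mathbf{0}$ be a system of $N$ polynomial equations in $n$ unknowns with complex coefficients, and let $\mathbf{x}^*\in\mathbb{C}^n$ be an isolated solution of $F(\mathbf{x})=\mathbf{0}$ of multiplicity $m$. Apply the deflation procedure (defined in the context) to $F$ at $\mathbf{x}^*$, with a generic choice of the pair $(B,\mathbf{h})$ at each deflation step. Then the number $d$ of deflation steps needed to restore the quadratic convergence of Newton's method, i.e. the smallest $d\ge 0$ such that the Jacobian matrix of the $d$-th deflated system $F^{(d)}$ at the corresponding solution $P^{(d)}=(\mathbf{x}^*,\boldsymbol{\lambda}^{(1)},\ldots,\boldsymbol{\lambda}^{(d)})$ has full column rank, exists and satisfies $d<m$.
   Context: A solution $\mathbf{x}^*$ of $F(\mathbf{x})=\mathbf{0}$ is isolated if for small enough $\epsilon>0$ it is the only solution in the ball $\{\mathbf{y}\in\mathbb{C}^n : \|\mathbf{y}-\mathbf{x}^*\|<\epsilon\}$. Its multiplicity is the (finite) dimension over $\mathbb{C}$ of the local ring $\mathbb{C}[\mathbf{x}]_{\mathfrak m}/\langle F\rangle\,\mathbb{C}[\mathbf{x}]_{\mathfrak m}$, where $\mathfrak m$ is the maximal ideal of the point $\mathbf{x}^*$ and $\langle F\rangle$ is the ideal generated by the polynomials of the system. Deflation procedure. Put $F^{(0)}=F$, $P^{(0)}=\mathbf{x}^*$, $n_0=n$, $N_0=N$. Suppose that $F^{(k)}$ is a system of $N_k$ polynomials in $n_k$ variables, collectively denoted $\mathbf{z}$, with solution $P^{(k)}\in\mathbb{C}^{n_k}$.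 Let $A^{(k)}(\mathbf{z})$ be its $N_k\times n_k$ Jacobian matrix, and let $r_k=\operatorname{rank}A^{(k)}(P^{(k)})$. If $r_k=n_k$, stop: the solution is regular, and Newton's method (the Gauss-Newton method when $N_k>n_k$) converges quadratically to it. If $r_k<n_k$, perform one deflation step: choose a matrix $B\in\mathbb{C}^{n_k\times(r_k+1)}$ and a vector $\mathbf{h}\in\mathbb{C}^{r_k+1}$, introduce $r_k+1$ new variables $\boldsymbol{\lambda}=(\lambda_1,\ldots,\lambda_{r_k+1})^T$, and let $F^{(k+1)}$ be the system in the $n_{k+1}=n_k+r_k+1$ variables $(\mathbf{z},\boldsymbol{\lambda})$ consisting of the $N_{k+1}=2N_k+1$ equations $$F^{(k)}(\mathbf{z})=\mathbf{0},\qquad A^{(k)}(\mathbf{z})\,B\,\boldsymbol{\lambda}=\mathbf{0},\qquad \sum_{i=1}^{r_k+1}h_i\lambda_i-1=0.$$ For generic $(B,\mathbf{h})$ there is exactly one vector $\boldsymbol{\lambda}^{(k+1)}\in\mathbb{C}^{r_k+1}$ satisfying $A^{(k)}(P^{(k)})B\boldsymbol{\lambda}^{(k+1)}=\mathbf{0}$ and $\sum_i h_i\lambda^{(k+1)}_i=1$; set $P^{(k+1)}=(P^{(k)},\boldsymbol{\lambda}^{(k+1)})$. Generic choice: at each step $k$ there is a proper algebraic subset $Z_k\subsetneq\mathbb{C}^{n_k\times(r_k+1)}\times\mathbb{C}^{r_k+1}$, depending only on $F^{(k)}$ and $P^{(k)}$ and containing all pairs $(B,\mathbf{h})$ for which $\boldsymbol{\lambda}^{(k+1)}$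 fails to exist or to be unique, such that the assertion holds whenever the pair $(B,\mathbf{h})$ chosen at each step $k$ lies outside $Z_k$ (in the procedure the pairs are chosen at random, and the assertion holds with probability one). *)

(* Defs.v *)
From mathcomp Require Import all_boot all_order all_algebra.
From mathcomp Require Import mpoly complex.
From mathcomp Require Import reals.

Set Implicit Arguments.
Unset Strict Implicit.
Unset Printing Implicit Defensive.

Import Order.TTheory GRing.Theory Num.Theory.
Local Open Scope ring_scope.

(* A system of N polynomials in n variables is a column F of polynomials, and a
   point of K^n is a column vector. *)

Definition evalp (K : fieldType) (n : nat) (a : 'cV[K]_n) (p : {mpoly K[n]}) : K :=
  p.@[fun i => a i 0].

Definition is_solution (K : fieldType) (n N : nat)
    (F : 'cV[{mpoly K[n]}]_N) (a : 'cV[K]_n) : Prop :=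
  forall i, evalp a (F i 0) = 0.

Definition enorm (R : realType) (n : nat) (v : 'cV[R[i]]_n) : R :=
  Num.sqrt (\sum_i Normc.normc (v i 0) ^+ 2).

Definition isolated_solution (R : realType) (n N : nat)
    (F : 'cV[{mpoly R[i][n]}]_N) (x : 'cV[R[i]]_n) : Prop :=
  is_solution F x /\
  exists2 eps : R, 0 < eps &
    forall y : 'cV[R[i]]_n, enorm (y - x) < eps -> is_solution F y -> y = x.

(* The localization K[x]_a of K[x] at the maximal ideal of the point a, as a subring
   of the field of rational functions. *)
Definition local_ring (K : fieldType) (n : nat) (a : 'cV[K]_n)
    (u : {fraction {mpoly K[n]}}) : Prop :=
  exists p q : {mpoly K[n]}, evalp a q != 0 /\ u = tofrac p / tofrac q.

(* The extended ideal <F> K[x]_a. *)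
Definition local_ideal (K : fieldType) (n N : nat)
    (F : 'cV[{mpoly K[n]}]_N) (a : 'cV[K]_n)
    (u : {fraction {mpoly K[n]}}) : Prop :=
  exists g : 'I_N -> {fraction {mpoly K[n]}},
    (forall i, local_ring a (g i)) /\ u = \sum_i g i * tofrac (F i 0).

(* dim_K (K[x]_a / <F> K[x]_a) = m: the quotient has a basis of m elements,
   namely the classes of e_1, ..., e_m. *)
Definition has_multiplicity (K : fieldType) (n N : nat)
    (F : 'cV[{mpoly K[n]}]_N) (a : 'cV[K]_n) (m : nat) : Prop :=
  exists e : 'I_m -> {fraction {mpoly K[n]}},
    (forall i, local_ring a (e i)) /\
    forall u, local_ring a u ->
      exists! c : 'cV[K]_m,
        local_ideal F a (u - \sum_i tofrac (c i 0)%:MP * e i).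

Definition jacobian (K : fieldType) (n N : nat) (F : 'cV[{mpoly K[n]}]_N) :
    'M[{mpoly K[n]}]_(N, n) :=
  \matrix_(i, j) (F i 0)^`M(j).

(* The polynomials of the deflated system, in the variables (z, lambda): z_i is
   'X_(lshift r i) and lambda_j is 'X_(rshift n j). *)
Definition deflated_system (K : fieldType) (n N r : nat)
    (F : 'cV[{mpoly K[n]}]_N) (B : 'M[K]_(n, r)) (h : 'cV[K]_r) :
    'cV[{mpoly K[n + r]}]_(N + N + 1) :=
  let in_z := comp_mpoly [tuple 'X_(lshift r i) | i < n] in
  let cst := @mpolyC (n + r) K in
  let lambda : 'cV[{mpoly K[n + r]}]_r := \col_j 'X_(rshift n j) in
  col_mx (col_mx (map_mx in_z F)
                 (map_mx in_z (jacobian F) *m map_mx cst B *m lambda))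
         ((map_mx cst h)^T *m lambda - 1%:M).

(* A pair (F^(k), P^(k)) occurring in the procedure. *)
Record pointed_system (K : fieldType) := PointedSystem {
  nvars : nat;
  neqs : nat;
  eqns : 'cV[{mpoly K[nvars]}]_neqs;
  point : 'cV[K]_nvars
}.

Definition jacobian_at (K : fieldType) (S : pointed_system K) :
    'M[K]_(neqs S, nvars S) :=
  map_mx (evalp (point S)) (jacobian (eqns S)).

Definition jrank (K : fieldType) (S : pointed_system K) : nat :=
  \rank (jacobian_at S).

Definition regular (K : fieldType) (S : pointed_system K) : Prop :=
  jrank S = nvars S.

Definition is_multiplier (K : fieldType) (S : pointed_system K)
    (B : 'M[K]_(nvars S, (jrank S).+1)) (h : 'cV[K]_(jrank S).+1)
    (lambda : 'cV[K]_(jrank S).+1) : Prop :=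
  jacobian_at S *m B *m lambda = 0 /\ \sum_i h i 0 * lambda i 0 = 1.

Definition deflate (K : fieldType) (S : pointed_system K)
    (B : 'M[K]_(nvars S, (jrank S).+1)) (h : 'cV[K]_(jrank S).+1)
    (lambda : 'cV[K]_(jrank S).+1) : pointed_system K :=
  PointedSystem (deflated_system (eqns S) B h) (col_mx (point S) lambda).

(* For each (F^(k), P^(k)), a set of pairs (B, h). *)
Definition exceptional_family (K : fieldType) : Type :=
  forall S : pointed_system K,
    'M[K]_(nvars S, (jrank S).+1) -> 'cV[K]_(jrank S).+1 -> Prop.

Definition algebraic_subset (K : fieldType) (n r : nat)
    (Z : 'M[K]_(n, r) -> 'cV[K]_r -> Prop) : Prop :=
  exists s : seq {mpoly K[n * r + r]},
    forall B h, Z B h <->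
      forall p, p \in s -> evalp (col_mx (mxvec B)^T h) p = 0.

Definition proper_subset (K : fieldType) (n r : nat)
    (Z : 'M[K]_(n, r) -> 'cV[K]_r -> Prop) : Prop :=
  exists B h, ~ Z B h.

Definition admissible (K : fieldType) (Z : exceptional_family K) : Prop :=
  forall S : pointed_system K,
    is_solution (eqns S) (point S) -> (jrank S < nvars S)%N ->
    [/\ algebraic_subset (@Z S), proper_subset (@Z S) &
        forall B h, ~ (exists! lambda, is_multiplier B h lambda) -> Z S B h].

(* A run of the procedure in which every chosen pair (B, h) avoids Z. The
   sequence is constant once the procedure has stopped. *)
Definition deflation_run (K : fieldType) (Z : exceptional_family K)
    (S : nat -> pointed_system K) : Prop :=
  forall k,
    (regular (S k) -> S k.+1 = S k) /\
    (~ regular (S k) ->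
       exists B h lambda,
         [/\ ~ Z (S k) B h, is_multiplier B h lambda &
             S k.+1 = deflate B h lambda]).

(* Main.v *)
From HB Require Import structures.
Require Import Defs.
From mathcomp Require Import all_boot all_order all_algebra.
From mathcomp Require Import mpoly complex.
From mathcomp Require Import reals.
From mathcomp Require boolp.
From mathcomp Require Import ring.

(** Each deflation step strictly lowers the multiplicity of the solution, and a
    solution has multiplicity at least 1.  So a run that starts at multiplicity
    m must reach a regular system in fewer than m steps.

    Here is why the multiplicity drops.  Write O for the local ring at the point
    P and I for the ideal that the system F generates in it.  Let A be the
    Jacobian matrix.  When the multiplier lambda at P is unique, the linear
    equations A B lambda = 0, h lambda = 1 contain a square subsystem which is
    invertible at P.  Cramer's rule then expresses lambda as a function
    lambda(z) with entries in O, so the local algebra of the deflated system is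
    a quotient of O / I.  With v the vector field B lambda(z) on z-space, the
    equations A B lambda = 0 become v(F_j) = 0.  By the Leibniz rule, v(f) then
    vanishes in the deflated algebra for every f in I.

    It remains to see that v(I) is not contained in I.  If B lambda is nonzero
    at P, some coordinate function y = z_i - P_i has v(y) invertible in O.  As
    O / I has finite dimension, y is nilpotent modulo I; take k minimal with y^k
    in I.  Then v(y^k) = k y^(k-1) v(y), and in characteristic 0 this makes
    y^(k-1) vanish in the deflated algebra, although y^(k-1) is not in I
    ([dirderiv_enlarges]).  Hence the dimension drops by at least one
    ([colength_le_drop], [colength_deflated]).

    Generic choice thus means two things: lambda is unique, and B is injective,
    so that B lambda <> 0.  Both follow when two determinants in (B, h) do not
    vanish, and the product of these determinants defines [exceptional_set].

    The argument is carried out on polynomials instead of elements of O: a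
    polynomial p lies in I exactly when q p lies in the polynomial ideal of F for
    some q with q(P) <> 0 ([locally_in_ideal]).  An upper bound on the dimension
    of O / I is expressed by linear dependence of polynomials modulo I
    ([colength_le]). *)

Set Implicit Arguments.
Unset Strict Implicit.
Unset Printing Implicit Defensive.

Import Order.TTheory GRing.Theory Num.Theory.
Local Open Scope ring_scope.

(** * Membership in the local ideal of a polynomial system *)

HB.instance Definition _ (K : fieldType) (n : nat) (a : 'cV[K]_n) :=
  GRing.RMorphism.copy (evalp a) (meval (fun i => a i 0)).

Lemma evalpC (K : fieldType) (n : nat) (a : 'cV[K]_n) (c : K) :
  evalp a c%:MP = c.
Proof. exact: mevalC. Qed.

Lemma evalpX (K : fieldType) (n : nat) (a : 'cV[K]_n) (i : 'I_n) :
  evalp a 'X_i = a i 0.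
Proof. exact: mevalXU. Qed.

Definition in_ideal (R : comPzRingType) (N : nat) (F : 'cV[R]_N) (p : R) : Prop :=
  exists G : 'rV[R]_N, p = (G *m F) 0 0.

(** For a polynomial p this is membership in the extended ideal <F> K[x]_a: the
    denominators of the coefficients are gathered in q. *)
Definition locally_in_ideal (K : fieldType) (n N : nat)
    (F : 'cV[{mpoly K[n]}]_N) (a : 'cV[K]_n) (p : {mpoly K[n]}) : Prop :=
  exists2 q, evalp a q != 0 & in_ideal F (q * p).

Section LocalMembership.

Variables (K : fieldType) (n N : nat) (F : 'cV[{mpoly K[n]}]_N) (a : 'cV[K]_n).

Local Notation J := (locally_in_ideal F a).

Lemma locally_in_ideal_gen i : J (F i 0).
Proof.
exists 1; first by rewrite rmorph1 oner_neq0.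
exists (delta_mx 0 i); rewrite mul1r -rowE !mxE //.
Qed.

Lemma locally_in_ideal0 : J 0.
Proof.
exists 1; first by rewrite rmorph1 oner_neq0.
by exists 0; rewrite mulr0 mul0mx mxE.
Qed.

Lemma locally_in_idealD p q : J p -> J q -> J (p + q).
Proof.
case=> u u0 [G eG] [v v0 [H eH]]; exists (u * v); first by rewrite rmorphM mulf_neq0.
exists (v *: G + u *: H); rewrite mulmxDl -!scalemxAl !mxE.
by move: eG eH; rewrite !mxE => <- <-; ring.
Qed.

Lemma locally_in_idealM p q : J q -> J (p * q).
Proof.
case=> u u0 [G eG]; exists u => //; exists (p *: G).
by rewrite -scalemxAl mxE -eG; ring.
Qed.

Lemma locally_in_idealN p : J p -> J (- p).
Proof. by rewrite -mulN1r; apply: locally_in_idealM. Qed.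

Lemma locally_in_idealB p q : J p -> J q -> J (p - q).
Proof.
by move=> Jp Jq; apply: locally_in_idealD Jp _; apply: locally_in_idealN.
Qed.

Lemma locally_in_ideal_sum (I : Type) (r : seq I) (P : pred I)
    (p : I -> {mpoly K[n]}) :
  (forall i, P i -> J (p i)) -> J (\sum_(i <- r | P i) p i).
Proof.
by move=> Jp; apply: big_ind; [exact: locally_in_ideal0 | exact: locally_in_idealD |].
Qed.

Lemma locally_in_ideal_cancel u p : evalp a u != 0 -> J (u * p) -> J p.
Proof.
move=> u0 [v v0 Hv]; exists (v * u); first by rewrite rmorphM mulf_neq0.
by rewrite -mulrA.
Qed.

Lemma locally_in_ideal_mulmx p q (A : 'M[{mpoly K[n]}]_(p, q))
    (C : 'cV[{mpoly K[n]}]_q) :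
  (forall i, J (C i 0)) -> forall i, J ((A *m C) i 0).
Proof.
move=> JC i; rewrite mxE; apply: locally_in_ideal_sum => j _.
exact: locally_in_idealM.
Qed.

Lemma eval_locally_in_ideal p : is_solution F a -> J p -> evalp a p = 0.
Proof.
move=> Fa [u u0 [G eG]]; apply: (mulfI u0); rewrite mulr0 -rmorphM eG mxE.
by rewrite rmorph_sum big1 // => i _; rewrite rmorphM /= Fa mulr0.
Qed.

End LocalMembership.

(** * Bounds on the colength *)

(** The bound dim (K[x]_a / <F> K[x]_a) <= m.  The image of K[x] in this quotient
    has the same dimension as the quotient when that dimension is finite, since
    it is then an Artinian local ring in which denominators are already
    invertible; testing polynomials is therefore enough. *)
Definition colength_le (K : fieldType) (n N : nat)
    (F : 'cV[{mpoly K[n]}]_N) (a : 'cV[K]_n) (m : nat) : Prop :=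
  forall p : 'I_m.+1 -> {mpoly K[n]},
    exists2 c : 'I_m.+1 -> K,
      exists i, c i != 0 & locally_in_ideal F a (\sum_i (c i)%:MP * p i).

Lemma left_kernel_neq0 (K : fieldType) (m : nat) (C : 'M[K]_(m.+1, m)) :
  exists2 d : 'rV[K]_m.+1, d != 0 & d *m C = 0.
Proof.
have : kermx C != 0.
  by rewrite kermx_eq0 /row_free neq_ltn ltnS rank_leq_col.
case/rowV0Pn => d /sub_kermxP dC d0; by exists d.
Qed.

Lemma local_ring_denominator (K : fieldType) (n N : nat) (a : 'cV[K]_n)
   (g : 'I_N -> {fraction {mpoly K[n]}}) :
  (forall i, local_ring a (g i)) ->
  exists2 q, evalp a q != 0 & forall i, exists p, tofrac q * g i = tofrac p.
Proof.
move=> Hg.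
have /fin_all_exists [p /fin_all_exists [q Hpq]] := Hg.
have nz i : tofrac (q i) != 0.
  have [qi _] := Hpq i; rewrite tofrac_eq0; apply: contraNneq qi => ->.
  by rewrite rmorph0.
exists (\prod_i q i) => [|i].
  by rewrite rmorph_prod; apply/prodf_neq0 => i _; case: (Hpq i).
exists ((\prod_(j | j != i) q j) * p i).
rewrite (bigD1 i) //= (proj2 (Hpq i)) !rmorphM /=.
by rewrite [X in X * _]mulrC mulrACA divff // mulr1.
Qed.

(** Contraction of the extended ideal to K[x]: clear denominators, then use that
    K[x] embeds in its fraction field. *)
Lemma local_ideal_tofrac (K : fieldType) (n N : nat)
    (F : 'cV[{mpoly K[n]}]_N) (a : 'cV[K]_n) (p : {mpoly K[n]}) :
  local_ideal F a (tofrac p) -> locally_in_ideal F a p.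
Proof.
case=> g [/local_ring_denominator [q q0 /fin_all_exists [G HG]] Hp].
exists q => //; exists (\row_i G i); apply/eqP; rewrite -tofrac_eq; apply/eqP.
rewrite rmorphM /= Hp mulr_sumr mxE rmorph_sum; apply: eq_bigr => i _.
by rewrite mulrA HG !mxE rmorphM.
Qed.

Lemma local_ideal_lincomb (K : fieldType) (n N : nat)
    (F : 'cV[{mpoly K[n]}]_N) (a : 'cV[K]_n) (k : nat) (c : 'I_k -> K)
    (u : 'I_k -> {fraction {mpoly K[n]}}) :
  (forall i, local_ideal F a (u i)) ->
  local_ideal F a (\sum_i tofrac (c i)%:MP * u i).
Proof.
move=> /fin_all_exists [g Hg].
exists (fun j => \sum_i tofrac (c i)%:MP * g i j); split=> [j|].
  have [q q0 /fin_all_exists [G HG]] :=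
    local_ring_denominator (fun i => proj1 (Hg i) j).
  have nz : tofrac q != 0.
    by rewrite tofrac_eq0; apply: contraNneq q0 => ->; rewrite rmorph0.
  exists (\sum_i (c i)%:MP * G i), q; split=> //.
  apply: (mulfI nz); rewrite [RHS]mulrC divfK // mulr_sumr rmorph_sum.
  by apply: eq_bigr => i _; rewrite mulrCA HG rmorphM.
rewrite (eq_bigr (fun i => \sum_j tofrac (c i)%:MP * (g i j * tofrac (F j 0)))).
  rewrite exchange_big; apply: eq_bigr => j _.
  by rewrite mulr_suml; apply: eq_bigr => i _; rewrite mulrA.
by move=> i _; rewrite (proj2 (Hg i)) mulr_sumr.
Qed.

(** The coordinates of m + 1 polynomials on a basis of m classes form an
    (m + 1) x m matrix; a vector in its left kernel is a linear relation. *)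
Lemma colength_le_multiplicity (K : fieldType) (n N : nat)
    (F : 'cV[{mpoly K[n]}]_N) (a : 'cV[K]_n) (m : nat) :
  has_multiplicity F a m -> colength_le F a m.
Proof.
case=> e [_ He] p.
have /fin_all_exists [c Hc] (i : 'I_m.+1) : exists c : 'cV[K]_m,
    local_ideal F a (tofrac (p i) - \sum_j tofrac (c j 0)%:MP * e j).
  have [|c [Hc _]] := He (tofrac (p i)); last by exists c.
  by exists (p i), 1; rewrite rmorph1 oner_neq0 rmorph1 divr1.
have [d d0 dC] := left_kernel_neq0 (\matrix_(i, j) c i j 0).
exists (d 0); first by apply/rV0Pn.
apply: local_ideal_tofrac; have := local_ideal_lincomb (d 0) Hc.
congr (local_ideal F a _); rewrite rmorph_sum.
under eq_bigr do rewrite mulrBr.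
rewrite sumrB [X in _ - X](_ : _ = 0) ?subr0.
  by apply: eq_bigr => i _; rewrite rmorphM.
under eq_bigr do rewrite mulr_sumr.
rewrite exchange_big big1 // => j _ /=.
under eq_bigr do rewrite mulrA -rmorphM -mpolyCM /=.
rewrite -mulr_suml -rmorph_sum /= -(raddf_sum (@mpolyC n K)).
have /matrixP/(_ 0 j) := dC; rewrite !mxE => dCj.
rewrite (_ : \sum_i _ = 0) ?raddf0 ?mul0r // -[RHS]dCj.
by apply: eq_bigr => i _; rewrite mxE.
Qed.

(** The powers 1, y, ..., y^m are dependent.  If y^i is the lowest power in a
    relation, the relation is y^i times a polynomial whose value at a is the
    coefficient of y^i, hence a local unit. *)
Lemma vanishing_nilpotent (K : fieldType) (n N : nat)
    (F : 'cV[{mpoly K[n]}]_N) (a : 'cV[K]_n) (m : nat) (y : {mpoly K[n]}) :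
  colength_le F a m -> evalp a y = 0 -> exists k, locally_in_ideal F a (y ^+ k).
Proof.
move=> /(_ (fun i => y ^+ i)) [c [i0 ci0] Hc] ya.
have [i ci cmin] := @arg_minnP _ i0 (fun i => c i != 0) val ci0.
exists i; pose u := \sum_(j : 'I_m.+1 | (i <= j)%N) (c j)%:MP * y ^+ (j - i).
apply: (@locally_in_ideal_cancel _ _ _ _ _ u).
  rewrite /u (bigD1 i) //= subnn expr0 mulr1 rmorphD /= evalpC rmorph_sum /=.
  rewrite big1 ?addr0 // => j /andP [lij ji].
  rewrite rmorphM rmorphXn /= ya expr0n subn_eq0 leqNgt ltn_neqAle lij.
  by rewrite eq_sym ji mulr0.
move: Hc; rewrite (bigID (fun j : 'I_m.+1 => i <= j)%N) /= [X in _ + X]big1 ?addr0.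
  congr (locally_in_ideal F a _); rewrite /u mulr_suml; apply: eq_bigr => j lij.
  by rewrite -mulrA -exprD subnK.
move=> j /negP lij; case: (eqVneq (c j) 0) => [->|/cmin //].
by rewrite mpolyC0 mul0r.
Qed.

(** When every p is locally congruent to a fraction phi g / phi u, the map induced
    by phi from the local algebra of F to that of F' is onto, and w is a nonzero
    element of its kernel.  In terms of relations: bring m polynomials to a common
    denominator U, and apply the hypothesis on F to w and their m numerators.
    The coefficients of the numerators are not all zero, since w alone satisfies
    no relation. *)
Lemma colength_le_drop (K : fieldType) (n N n' N' : nat)
    (F : 'cV[{mpoly K[n]}]_N) (a : 'cV[K]_n)
    (F' : 'cV[{mpoly K[n']}]_N') (a' : 'cV[K]_n')
    (phi : {rmorphism {mpoly K[n]} -> {mpoly K[n']}}) (w : {mpoly K[n]}) (m : nat) :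
  (forall c, phi c%:MP = c%:MP) ->
  (forall p, evalp a' (phi p) = evalp a p) ->
  (forall p, locally_in_ideal F a p -> locally_in_ideal F' a' (phi p)) ->
  (forall p, exists2 u, evalp a u != 0 &
     exists g, locally_in_ideal F' a' (phi u * p - phi g)) ->
  locally_in_ideal F' a' (phi w) -> ~ locally_in_ideal F a w ->
  colength_le F a m.+1 -> colength_le F' a' m.
Proof.
move=> phiC phia phiF fracP phiw Nw cl p.
have {fracP} /fin_all_exists2 [u u0 /fin_all_exists [g Hg]] := fun i => fracP (p i).
pose f i := (\prod_(j | j != i) u j) * g i.
pose U := \prod_j u j.
have Uf i : locally_in_ideal F' a' (phi U * p i - phi (f i)).
  rewrite /U /f (bigD1 i) //= [u i * _]mulrC !rmorphM /= -mulrA -mulrBr.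
  exact: locally_in_idealM.
have [c [k ck] Hc] := cl (fun i => if unlift 0 i is Some j then f j else w).
move: Hc; rewrite big_ord_recl unlift_none.
under eq_bigr do rewrite liftK.
move=> Hc.
have [j cj|c0] := pickP (fun j => c (lift 0 j) != 0); last first.
  case: Nw; apply: (@locally_in_ideal_cancel _ _ _ _ _ (c 0)%:MP).
    rewrite evalpC; case: (unliftP 0 k) ck => [j ->|-> //].
    by move: (c0 j) => /= ->.
  move: Hc; rewrite big1 ?addr0 // => j _.
  by move/negbFE/eqP: (c0 j) => ->; rewrite mpolyC0 mul0r.
exists (fun j => c (lift 0 j)); first by exists j.
apply: (@locally_in_ideal_cancel _ _ _ _ _ (phi U)).
  by rewrite phia rmorph_prod; apply/prodf_neq0 => i _; apply: u0.
have -> : phi U * (\sum_i (c (lift 0 i))%:MP * p i) =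
    phi ((c 0)%:MP * w + \sum_i (c (lift 0 i))%:MP * f i) - (c 0)%:MP * phi w
    + \sum_i (c (lift 0 i))%:MP * (phi U * p i - phi (f i)).
  rewrite rmorphD rmorphM rmorph_sum /= !phiC [_ + _ - _]addrAC subrr add0r -big_split.
  rewrite mulr_sumr; apply: eq_bigr => i _ /=; rewrite rmorphM /= phiC; ring.
apply: locally_in_idealD.
  apply: locally_in_idealB; first exact: phiF.
  exact: locally_in_idealM.
apply: locally_in_ideal_sum => i _; exact: locally_in_idealM.
Qed.

(** * Vector fields and local ideals *)

Definition dirderiv (R : comNzRingType) (n : nat) (V : 'cV[{mpoly R[n]}]_n)
    (p : {mpoly R[n]}) : {mpoly R[n]} :=
  \sum_i V i 0 * p^`M(i).

Lemma dirderivM (R : comNzRingType) (n : nat) (V : 'cV[{mpoly R[n]}]_n) p q :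
  dirderiv V (p * q) = dirderiv V p * q + p * dirderiv V q.
Proof.
rewrite /dirderiv mulr_suml mulr_sumr -big_split; apply: eq_bigr => i _ /=.
by rewrite mderivM; ring.
Qed.

Lemma dirderiv_sum (R : comNzRingType) (n : nat) (V : 'cV[{mpoly R[n]}]_n)
    (I : finType) (p : I -> {mpoly R[n]}) :
  dirderiv V (\sum_i p i) = \sum_i dirderiv V (p i).
Proof.
rewrite /dirderiv exchange_big; apply: eq_bigr => i _.
by rewrite linear_sum mulr_sumr.
Qed.

Lemma dirderiv_coord (R : comNzRingType) (n : nat) (V : 'cV[{mpoly R[n]}]_n)
    (i : 'I_n) (c : R) (k : nat) :
  dirderiv V (('X_i - c%:MP) ^+ k.+1) = k.+1%:R * V i 0 * ('X_i - c%:MP) ^+ k.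
Proof.
have dX : dirderiv V ('X_i - c%:MP) = V i 0.
  rewrite /dirderiv (bigD1 i) //= big1 => [|j ji].
    rewrite mderivB mderivC subr0 mderivX mnmE eqxx scale1r addr0.
    by rewrite (_ : U_(i) - U_(i) = 0)%MM ?mpolyX0 ?mulr1 //; apply/mnmP => j; rewrite !mnmE subnn.
  by rewrite mderivB mderivC subr0 mderivX mnmE eq_sym (negbTE ji) scale0r mulr0.
elim: k => [|k IHk]; first by rewrite expr1 dX expr0 mulr1 mul1r.
rewrite exprS dirderivM dX IHk [X in _ = X * _ * _]mulrS exprS; ring.
Qed.

Lemma locally_in_ideal_morph (K : fieldType) (n N n' N' : nat)
    (F : 'cV[{mpoly K[n]}]_N) (a : 'cV[K]_n)
    (F' : 'cV[{mpoly K[n']}]_N') (a' : 'cV[K]_n')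
    (phi : {rmorphism {mpoly K[n]} -> {mpoly K[n']}}) :
  (forall p, evalp a' (phi p) = evalp a p) ->
  (forall i, locally_in_ideal F' a' (phi (F i 0))) ->
  forall p, locally_in_ideal F a p -> locally_in_ideal F' a' (phi p).
Proof.
move=> phia phiF p [q q0 [G eG]].
apply: (@locally_in_ideal_cancel _ _ _ _ _ (phi q)); first by rewrite phia.
rewrite -rmorphM eG mxE rmorph_sum; apply: locally_in_ideal_sum => i _.
by rewrite rmorphM; apply: locally_in_idealM.
Qed.

(** By the Leibniz rule, v(f) for f in the ideal is a combination of the F_i and
    the v(F_i); so controlling v on the generators is enough. *)
Lemma locally_in_ideal_dirderiv (K : fieldType) (n N n' N' : nat)
    (F : 'cV[{mpoly K[n]}]_N) (a : 'cV[K]_n)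
    (F' : 'cV[{mpoly K[n']}]_N') (a' : 'cV[K]_n')
    (phi : {rmorphism {mpoly K[n]} -> {mpoly K[n']}})
    (V : 'cV[{mpoly K[n]}]_n) :
  (forall p, evalp a' (phi p) = evalp a p) ->
  (forall i, locally_in_ideal F' a' (phi (F i 0))) ->
  (forall i, locally_in_ideal F' a' (phi (dirderiv V (F i 0)))) ->
  forall p, locally_in_ideal F a p -> locally_in_ideal F' a' (phi (dirderiv V p)).
Proof.
move=> phia phiF phiVF p Fp.
have phip := locally_in_ideal_morph phia phiF Fp.
case: Fp => q q0 [G eG].
apply: (@locally_in_ideal_cancel _ _ _ _ _ (phi q)); first by rewrite phia.
have -> : phi q * phi (dirderiv V p) =
    phi (dirderiv V (q * p)) - phi (dirderiv V q) * phi p.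
  by rewrite dirderivM rmorphD !rmorphM /= addrC addKr.
apply: locally_in_idealB; last exact: locally_in_idealM.
rewrite eG mxE dirderiv_sum rmorph_sum; apply: locally_in_ideal_sum => i _.
rewrite dirderivM rmorphD !rmorphM /=.
by apply: locally_in_idealD; apply: locally_in_idealM.
Qed.

(** No ideal of finite colength at a is preserved by a vector field that does not
    vanish at a: differentiating the least power of y = x_i - a_i which lies in
    the ideal produces the previous power, up to a unit.  This is where
    characteristic 0 enters. *)
Lemma dirderiv_enlarges (K : fieldType) (n N n' N' m : nat)
    (F : 'cV[{mpoly K[n]}]_N) (a : 'cV[K]_n)
    (F' : 'cV[{mpoly K[n']}]_N') (a' : 'cV[K]_n')
    (phi : {rmorphism {mpoly K[n]} -> {mpoly K[n']}})
    (V : 'cV[{mpoly K[n]}]_n) (i : 'I_n) :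
  [pchar K] =i pred0 ->
  is_solution F a -> colength_le F a m -> evalp a (V i 0) != 0 ->
  (forall p, evalp a' (phi p) = evalp a p) ->
  (forall p, locally_in_ideal F a p -> locally_in_ideal F' a' (phi (dirderiv V p))) ->
  exists2 w, locally_in_ideal F' a' (phi w) & ~ locally_in_ideal F a w.
Proof.
move=> K0 Fa cl Vi phia phiV; pose y : {mpoly K[n]} := 'X_i - (a i 0)%:MP.
have [|k] := vanishing_nilpotent (y := y) cl.
  by rewrite rmorphB /= evalpX evalpC subrr.
elim: k => [|k IHk] Fyk.
  by have /eqP := eval_locally_in_ideal Fa Fyk; rewrite expr0 rmorph1 oner_eq0.
have [/IHk //|Nyk] := boolp.EM (locally_in_ideal F a (y ^+ k)).
exists (y ^+ k) => //; move/phiV: Fyk; rewrite dirderiv_coord rmorphM /=.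
apply: locally_in_ideal_cancel; rewrite phia rmorphM rmorph_nat mulf_neq0 //.
by have /pcharf0P -> := K0.
Qed.

(** * The deflated system *)

Section Deflation.

Variables (K : fieldType) (n N r : nat).
Variables (F : 'cV[{mpoly K[n]}]_N) (a : 'cV[K]_n).
Variables (B : 'M[K]_(n, r)) (h lam : 'cV[K]_r).

Let phi : {rmorphism {mpoly K[n]} -> {mpoly K[n + r]}} :=
  comp_mpoly [tuple 'X_(lshift r i) | i < n].
Let F' := deflated_system F B h.
Let a' := col_mx a lam.
Let A0 := map_mx (evalp a) (jacobian F).
Let cst {k} := @mpolyC k K.
Let X : 'cV[{mpoly K[n + r]}]_r := \col_j 'X_(rshift n j).

Lemma evalp_embed p : evalp a' (phi p) = evalp a p.
Proof.
rewrite /evalp /phi /= comp_mpoly_meval; apply: meval_eq => i.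
by rewrite tnth_mktuple mevalXU col_mxEu.
Qed.

Lemma embedC c : phi c%:MP = c%:MP.
Proof. exact: comp_mpolyC. Qed.

Lemma map_embedC p q (M : 'M[K]_(p, q)) : map_mx phi (map_mx cst M) = map_mx cst M.
Proof. by apply/matrixP => i j; rewrite !mxE embedC. Qed.

Lemma map_evalpC p q k (b : 'cV[K]_k) (M : 'M[K]_(p, q)) :
  map_mx (evalp b) (map_mx cst M) = M.
Proof. by apply/matrixP => i j; rewrite !mxE evalpC. Qed.

Lemma deflated_original i : locally_in_ideal F' a' (phi (F i 0)).
Proof.
have := locally_in_ideal_gen F' a' (lshift 1 (lshift N i)).
by rewrite !col_mxEu mxE.
Qed.

Lemma deflated_tangent i :
  locally_in_ideal F' a' ((map_mx phi (jacobian F) *m map_mx cst B *m X) i 0).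
Proof.
have := locally_in_ideal_gen F' a' (lshift 1 (rshift N i)).
by rewrite col_mxEu col_mxEd.
Qed.

Lemma deflated_normalization i :
  locally_in_ideal F' a' (((map_mx cst h)^T *m X - 1%:M) i 0).
Proof.
have := locally_in_ideal_gen F' a' (rshift (N + N) i).
by rewrite col_mxEd.
Qed.

Lemma map_evalp_X : map_mx (evalp a') X = lam.
Proof. by apply/colP => j; rewrite !mxE evalpX col_mxEd. Qed.

Lemma deflated_solution :
  is_solution F a -> A0 *m B *m lam = 0 -> h^T *m lam = 1%:M ->
  is_solution F' a'.
Proof.
move=> Fa AB hl.
suff : map_mx (evalp a') F' = 0 by move=> /colP E i; have := E i; rewrite !mxE.
rewrite /F' /deflated_system !map_col_mx.
rewrite map_mxB !map_mxM /= -map_trmx -/X map_evalp_X.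
rewrite (map_evalpC a' B) (map_evalpC a' h) map_mx1 hl subrr.
rewrite (_ : map_mx _ (map_mx _ F) = 0); last first.
  by apply/colP => i; rewrite !mxE evalp_embed Fa.
rewrite (_ : map_mx _ (map_mx _ (jacobian F)) = A0); last first.
  by apply/matrixP => i j; rewrite [LHS]mxE [in LHS]mxE evalp_embed [RHS]mxE.
by rewrite AB !col_mx0.
Qed.

Variables (Q : 'M[K]_(r, N)) (e : 'cV[K]_r).

Let T : 'M[{mpoly K[n]}]_r :=
  map_mx cst Q *m jacobian F *m map_mx cst B + map_mx cst e *m (map_mx cst h)^T.
Let D := \det T.
Let V := \adj T *m map_mx cst e.

(** Cramer's rule.  Modulo the deflated ideal, lambda solves T lambda = e, where T
    combines the rows of A(z) B by Q and adds the normalization h lambda = 1 along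
    e.  So (det T) lambda is congruent to V = adj(T) e, a vector of polynomials in
    z alone. *)
Lemma deflated_multiplier i :
  locally_in_ideal F' a' ((phi D *: X - map_mx phi V) i 0).
Proof.
pose T' := map_mx phi T.
have eT' : T' = map_mx cst Q *m map_mx phi (jacobian F) *m map_mx cst B
                 + map_mx cst e *m (map_mx cst h)^T.
  by rewrite /T' map_mxD !map_mxM /= -map_trmx !map_embedC.
have -> : phi D *: X - map_mx phi V = \adj T' *m (T' *m X - map_mx cst e).
  rewrite mulmxBr mulmxA mul_adj_mx mul_scalar_mx /T' -map_mx_adj det_map_mx.
  by rewrite /V map_mxM map_embedC.
apply: locally_in_ideal_mulmx => {}i.
have -> : T' *m X - map_mx cst e =
    map_mx cst Q *m (map_mx phi (jacobian F) *m map_mx cst B *m X)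
    + map_mx cst e *m ((map_mx cst h)^T *m X - 1%:M).
  by rewrite eT' mulmxDl mulmxBr mulmx1 !mulmxA addrA.
rewrite mxE; apply: locally_in_idealD; apply: locally_in_ideal_mulmx.
  exact: deflated_tangent.
by move=> j; rewrite (ord1 j); apply: deflated_normalization.
Qed.

(** The vector field here is det T times the field B lambda(z), and A B lambda
    belongs to the deflated ideal. *)
Lemma deflated_dirderiv i :
  locally_in_ideal F' a' (phi (dirderiv (map_mx cst B *m V) (F i 0))).
Proof.
have -> : phi (dirderiv (map_mx cst B *m V) (F i 0)) =
    (map_mx phi (jacobian F) *m map_mx cst B *m map_mx phi V) i 0.
  rewrite -(map_embedC B) -!map_mxM [RHS]mxE -mulmxA; congr (phi _).
  by rewrite mxE; apply: eq_bigr => j _; rewrite [jacobian F i j]mxE mulrC.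
have -> : map_mx phi V = phi D *: X - (phi D *: X - map_mx phi V).
  by rewrite opprB addrC subrK.
rewrite mulmxBr -scalemxAr mxE [in X in X + _]mxE [in X in _ + X]mxE.
apply: locally_in_idealB.
  by apply: locally_in_idealM; apply: deflated_tangent.
by apply: locally_in_ideal_mulmx; apply: deflated_multiplier.
Qed.

Lemma evalp_det : evalp a D = \det (Q *m A0 *m B + e *m h^T).
Proof.
by rewrite -det_map_mx map_mxD !map_mxM /= -map_trmx !map_evalpC.
Qed.

Hypothesis D0 : \det (Q *m A0 *m B + e *m h^T) != 0.

(** Eliminating lambda = V / det T turns every polynomial in (z, lambda) into a
    fraction in z. *)
Lemma deflated_fraction p :
  exists2 u, evalp a u != 0 &
    exists g, locally_in_ideal F' a' (phi u * p - phi g).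
Proof.
pose frac q := exists2 u, evalp a u != 0 &
  exists g, locally_in_ideal F' a' (phi u * q - phi g).
have fracD q1 q2 : frac q1 -> frac q2 -> frac (q1 + q2).
  case=> u1 u10 [g1 J1] [u2 u20 [g2 J2]].
  exists (u1 * u2); first by rewrite rmorphM mulf_neq0.
  exists (u2 * g1 + u1 * g2).
  have -> : phi (u1 * u2) * (q1 + q2) - phi (u2 * g1 + u1 * g2) =
      phi u2 * (phi u1 * q1 - phi g1) + phi u1 * (phi u2 * q2 - phi g2).
    by rewrite rmorphD !rmorphM /=; ring.
  by apply: locally_in_idealD; apply: locally_in_idealM.
have fracM q1 q2 : frac q1 -> frac q2 -> frac (q1 * q2).
  case=> u1 u10 [g1 J1] [u2 u20 [g2 J2]].
  exists (u1 * u2); first by rewrite rmorphM mulf_neq0.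
  exists (g1 * g2).
  have -> : phi (u1 * u2) * (q1 * q2) - phi (g1 * g2) =
      (phi u2 * q2) * (phi u1 * q1 - phi g1) + phi g1 * (phi u2 * q2 - phi g2).
    by rewrite !rmorphM /=; ring.
  by apply: locally_in_idealD; apply: locally_in_idealM.
have frac_embed q : frac (phi q).
  exists 1; first by rewrite rmorph1 oner_neq0.
  by exists q; rewrite rmorph1 mul1r subrr; apply: locally_in_ideal0.
have fracC c : frac c%:MP by rewrite -embedC.
have frac0 : frac 0 by have := fracC 0; rewrite mpolyC0.
have frac1 : frac 1 by have := fracC 1; rewrite mpolyC1.
have fracX j : frac 'X_j.
  rewrite -(splitK j); case: (split j) => k /=.
    by have := frac_embed 'X_k;
      rewrite /phi /= comp_mpolyXU -tnth_nth tnth_mktuple.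
  exists D; [by rewrite evalp_det | exists (V k 0)].
  by have := deflated_multiplier k; rewrite !mxE.
elim/mpolyind: p => [//|c m p _ _ IHp].
apply: fracD IHp; rewrite -mul_mpolyC; apply: (fracM) => //.
rewrite mpolyXE_id; apply: (big_ind frac frac1 fracM) => j _.
elim: (m j) => [|k IHk]; first by rewrite expr0.
by rewrite exprS; apply: (fracM).
Qed.

Lemma evalp_multiplier :
  A0 *m B *m lam = 0 -> h^T *m lam = 1%:M ->
  map_mx (evalp a) V = evalp a D *: lam.
Proof.
move=> AB hl.
have Tlam : map_mx (evalp a) T *m lam = e.
  rewrite map_mxD !map_mxM /= -map_trmx !map_evalpC mulmxDl -!mulmxA.
  by rewrite [A0 *m _]mulmxA AB mulmx0 add0r hl mulmx1.
rewrite map_mxM map_mx_adj map_evalpC -{1}Tlam mulmxA mul_adj_mx.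
by rewrite mul_scalar_mx det_map_mx.
Qed.

Lemma colength_deflated m :
  [pchar K] =i pred0 -> is_solution F a ->
  A0 *m B *m lam = 0 -> h^T *m lam = 1%:M -> B *m lam != 0 ->
  colength_le F a m.+1 -> colength_le F' a' m.
Proof.
move=> K0 Fa AB hl Bl cl.
have [i Bi] : exists i, (B *m lam) i 0 != 0 by apply/cV0Pn.
have Vi : evalp a ((map_mx cst B *m V) i 0) != 0.
  have -> : evalp a ((map_mx cst B *m V) i 0) =
      map_mx (evalp a) (map_mx cst B *m V) i 0 by rewrite [RHS]mxE.
  rewrite map_mxM map_evalpC evalp_multiplier // -scalemxAr mxE.
  by rewrite mulf_neq0 ?evalp_det.
have [w Jw Nw] := dirderiv_enlarges K0 Fa cl Vi evalp_embed
  (locally_in_ideal_dirderiv evalp_embed deflated_original deflated_dirderiv).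
apply: (colength_le_drop embedC evalp_embed _ deflated_fraction Jw Nw cl).
exact: locally_in_ideal_morph evalp_embed deflated_original.
Qed.

End Deflation.

(** * The exceptional set *)

Section Exceptional.

Variables (K : fieldType) (n N : nat) (A : 'M[K]_(N, n)).

Local Notation r := (\rank A).
Local Notation e := (delta_mx ord_max 0 : 'cV[K]_(\rank A).+1).

(** The first r rows of the factor [row_ebase A] span the row space of A, so they
    carry the equations A B lambda = 0; [pid_mx r] keeps these and leaves the last
    row free for h. *)
Definition multiplier_mx (B : 'M[K]_(n, r.+1)) (h : 'cV[K]_r.+1) : 'M[K]_r.+1 :=
  pid_mx r *m row_ebase A *m B + e *m h^T.

(** The rows are r + 1 combinations of rows of B, so invertibility makes B
    injective.  The first r of them are those of [multiplier_mx] before h is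
    added, which lets one choice of (B, h) make both matrices the identity. *)
Definition direction_mx (B : 'M[K]_(n, r.+1)) : 'M[K]_r.+1 :=
  pid_mx r.+1 *m row_ebase A *m B.

Lemma pid_mx_ord_max : (pid_mx r : 'M_r.+1) *m e = 0.
Proof.
rewrite -colE; apply/colP => i; rewrite !mxE; case: eqP => //= ->.
by rewrite ltnn.
Qed.

Lemma pid_mx_row_ebase :
  pid_mx r *m row_ebase A = (pid_mx r : 'M_(r.+1, N)) *m invmx (col_ebase A) *m A.
Proof.
rewrite -[X in _ = _ *m X]mulmx_ebase !mulmxA mulmxKV ?col_ebase_unit //.
by rewrite pid_mx_id ?rank_leq_row.
Qed.

Lemma multiplier_mxP B h (lam : 'cV[K]_r.+1) :
  A *m B *m lam = 0 /\ h^T *m lam = 1%:M <-> multiplier_mx B h *m lam = e.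
Proof.
rewrite mulmxDl -[e *m _ *m _]mulmxA; split=> [[AB hl]|Tl].
  by rewrite pid_mx_row_ebase hl mulmx1 -!mulmxA (mulmxA A B lam) AB !mulmx0 add0r.
have EB : (pid_mx r : 'M_(r.+1, n)) *m row_ebase A *m B *m lam = 0.
  have := congr1 (mulmx (pid_mx r : 'M_r.+1)) Tl.
  by rewrite mulmxDr !mulmxA pid_mx_ord_max !mul0mx addr0 pid_mx_id.
split.
  rewrite -[X in X *m B]mulmx_ebase -(@pid_mx_id _ _ r.+1 _ r) //.
  by rewrite -!mulmxA [pid_mx r *m (row_ebase A *m _)]mulmxA (mulmxA _ B) EB !mulmx0.
move: Tl; rewrite EB add0r => /matrixP/(_ ord_max 0).
rewrite mxE big_ord1 !mxE !eqxx mul1r => hl.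
by apply/matrixP => i j; rewrite !ord1 [RHS]mxE eqxx -hl mxE.
Qed.

Lemma multiplier_unique B h :
  \det (multiplier_mx B h) != 0 ->
  exists! lam : 'cV[K]_r.+1, A *m B *m lam = 0 /\ h^T *m lam = 1%:M.
Proof.
rewrite -unitfE -unitmxE => uT; exists (invmx (multiplier_mx B h) *m e); split.
  by apply/multiplier_mxP; rewrite mulKVmx.
by move=> lam /multiplier_mxP <-; rewrite mulKmx.
Qed.

Lemma direction_neq0 B (lam : 'cV[K]_r.+1) :
  \det (direction_mx B) != 0 -> lam != 0 -> B *m lam != 0.
Proof.
rewrite -unitfE -unitmxE => uT; apply: contraNneq => Bl.
by rewrite -(mulKmx uT lam) -[direction_mx B *m _]mulmxA Bl !mulmx0.
Qed.

Lemma exceptional_proper :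
  (r < n)%N -> exists B h, \det (multiplier_mx B h) * \det (direction_mx B) != 0.
Proof.
move=> rn; exists (invmx (row_ebase A) *m pid_mx r.+1), e.
rewrite /multiplier_mx /direction_mx !mulmxA !mulmxK ?row_ebase_unit //.
rewrite pid_mx_id // pid_mx_1 det1 mulr1 mul_pid_mx.
rewrite (minn_idPl (leqnSn r)) (minn_idPr (ltnW rn)).
rewrite (_ : _ + _ = 1%:M) ?det1 ?oner_neq0 //.
apply/matrixP => i j; rewrite !mxE big_ord1 !mxE.
have lt_r (k : 'I_r.+1) : (k < r)%N = (k != ord_max).
  by rewrite -val_eqE /= ltn_neqAle -ltnS ltn_ord andbT.
rewrite lt_r !andbT.
case: (eqVneq i ord_max) => [->|im] /=; rewrite ?andbF ?andbT ?add0r ?mul0r ?addr0 //.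
by rewrite mul1r -val_eqE eq_sym.
Qed.

(** The determinants are those of matrices of polynomials in the generic entries
    X of B and y of h. *)
Lemma exceptional_algebraic :
  algebraic_subset (fun B h => \det (multiplier_mx B h) * \det (direction_mx B) = 0).
Proof.
pose X : 'M[{mpoly K[n * r.+1 + r.+1]}]_(n, r.+1) :=
  \matrix_(i, j) 'X_(lshift r.+1 (mxvec_index i j)).
pose y : 'cV[{mpoly K[n * r.+1 + r.+1]}]_r.+1 := \col_j 'X_(rshift (n * r.+1) j).
pose cst := @mpolyC (n * r.+1 + r.+1) K.
pose p := \det (map_mx cst (pid_mx r *m row_ebase A) *m X + map_mx cst e *m y^T) *
  \det (map_mx cst (pid_mx r.+1 *m row_ebase A) *m X).
exists [:: p] => B h; set b := col_mx _ _.
have eX : map_mx (evalp b) X = B.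
  by apply/matrixP => i j; rewrite !mxE evalpX col_mxEu mxE mxvecE.
have ey : map_mx (evalp b) y = h.
  by apply/colP => j; rewrite !mxE evalpX col_mxEd.
have ep : evalp b p = \det (multiplier_mx B h) * \det (direction_mx B).
  rewrite rmorphM -!det_map_mx map_mxD !map_mxM /= -map_trmx eX ey.
  by rewrite !(map_evalpC b).
split=> [Zp q|Zp]; last by rewrite -ep Zp ?inE.
by rewrite inE => /eqP ->; rewrite ep.
Qed.

End Exceptional.

(** * Length of a deflation run *)

Definition exceptional_set (K : fieldType) : exceptional_family K :=
  fun S B h =>
    \det (multiplier_mx B h) * \det (direction_mx (A := jacobian_at S) B) = 0.

Lemma is_multiplierE (K : fieldType) (S : pointed_system K) B h lam :
  is_multiplier (S := S) B h lam <->
  jacobian_at S *m B *m lam = 0 /\ h^T *m lam = 1%:M.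
Proof.
have hE : (h^T *m lam) = (\sum_i h i 0 * lam i 0)%:M.
  by rewrite [LHS]mx11_scalar mxE; under eq_bigr do rewrite mxE.
rewrite /is_multiplier hE; split=> -[-> hl]; split=> //; first by rewrite hl.
by move/matrixP/(_ 0 0): hl; rewrite !mxE eqxx.
Qed.

Lemma exceptional_set_admissible (K : fieldType) :
  admissible (@exceptional_set K).
Proof.
move=> S _ rS; split; first exact: exceptional_algebraic.
  by have [B [h /eqP ZBh]] := exceptional_proper rS; exists B, h.
move=> B h; rewrite /exceptional_set => Nuniq; apply/eqP.
rewrite mulf_eq0; case: eqVneq => //= /multiplier_unique [lam [lamP lamU]].
case: Nuniq; exists lam; split=> [|mu]; first by apply/is_multiplierE.
by move/is_multiplierE/lamU.
Qed.

Lemma colength_deflate (K : fieldType) (S : pointed_system K) B h lam m :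
  [pchar K] =i pred0 -> is_solution (eqns S) (point S) ->
  ~ exceptional_set (S := S) B h -> is_multiplier B h lam ->
  colength_le (eqns S) (point S) m.+1 ->
  is_solution (eqns (deflate B h lam)) (point (deflate B h lam)) /\
  colength_le (eqns (deflate B h lam)) (point (deflate B h lam)) m.
Proof.
move=> K0 FP /eqP; rewrite mulf_eq0 negb_or => /andP [T0 C0].
move=> /is_multiplierE [AB hl] cl; split; first exact: deflated_solution.
move: T0; rewrite /multiplier_mx pid_mx_row_ebase => T0.
apply: (colength_deflated T0 K0 FP AB hl _ cl).
apply: direction_neq0 C0 _; apply: contra_eq_neq hl => ->.
by rewrite mulmx0 eq_sym; apply: oner_neq0.
Qed.

(** Induction on the colength bound.  The bound 0 is impossible: it would put a
    nonzero constant in the ideal, while every element of the ideal vanishes at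
    the solution. *)
Lemma deflation_run_length (K : fieldType) (m : nat) (S : nat -> pointed_system K) :
  [pchar K] =i pred0 -> is_solution (eqns (S 0%N)) (point (S 0%N)) ->
  colength_le (eqns (S 0%N)) (point (S 0%N)) m ->
  deflation_run (@exceptional_set K) S ->
  exists d, [/\ regular (S d), forall k, (k < d)%N -> ~ regular (S k) & (d < m)%N].
Proof.
move=> K0; elim: m S => [|m IHm] S FP cl run.
  have [c [i ci]] := cl (fun=> 1).
  move/(eval_locally_in_ideal FP); rewrite big_ord1 mulr1 evalpC.
  by move: ci; rewrite (ord1 i) => /eqP.
have [reg|/eqP Nreg] := eqVneq (jrank (S 0%N)) (nvars (S 0%N)); first by exists 0%N.
have [_ /(_ Nreg) [B [h [lam [NZ mul S1]]]]] := run 0%N.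
have [] := colength_deflate K0 FP NZ mul cl; rewrite -S1 => FP1 cl1.
have [d [regd Nregd dm]] := IHm (fun k => S k.+1) FP1 cl1 (fun k => run k.+1).
by exists d.+1; split=> // -[|k] // /Nregd.
Qed.

Theorem theorem3p1 (R : realType) :
  exists Z : exceptional_family R[i],
    admissible Z /\
    forall (n N : nat) (F : 'cV[{mpoly R[i][n]}]_N) (x : 'cV[R[i]]_n) (m : nat),
      isolated_solution F x -> has_multiplicity F x m ->
      forall S : nat -> pointed_system R[i],
        S 0%N = PointedSystem F x -> deflation_run Z S ->
        exists d : nat,
          [/\ regular (S d),
              (forall k : nat, (k < d)%N -> ~ regular (S k)) &
              (d < m)%N].
Proof.
exists (@exceptional_set _); split; first exact: exceptional_set_admissible.
move=> n N F x m [Fx _] mult S S0 run.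
apply: deflation_run_length run; rewrite ?S0 //; first exact: pchar_num.
exact: colength_le_multiplicity.
Qed.
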